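(* Let $\mathbf{V}$ be a variety of interior algebras. The restriction of the functor $\mathcal{O}$ to $\mathbf{V}$ is full (i.e. for all $A,B\in\mathbf{V}$, every Heyting algebra homomorphism $A^\circ\to B^\circ$ equals $\mathcal{O}(h)$ for some interior algebra homomorphism $h\colon A\to B$) if and only if $\mathbf{V}$ is a locally finite $^*$-variety. In this case, $\mathbf{V}$ and $\gamma(\mathbf{V})=\{A^\circ: A\in\mathbf{V}\}$ are categorically equivalent.
   Context: An interior algebra $\langle B,g\rangle$ is a Boolean algebra with an operator $g$ satisfying $g(1)=1$, $g(x\cdot y)=g(x)\cdot g(y)$, $g(x)\le x$, $g(g(x))=g(x)$; $a$ is open if $g(a)=a$. $\mathcal{O}(B)=B^\circ$ is the Heyting algebra of open elements with $a\Rightarrow b=g(-a+b)$, and for a homomorphism $h$, $\mathcal{O}(h)$ is the restriction of $h$ to open elements. $B$ is a $^*$-algebra if it is generated by its open elements; a variety $\mathbf{V}$ of interior algebras is a $^*$-variety if it is generated by the $^*$-algebras it contains. Two varieties are categorically equivalent if there is a full and faithful functor between them that is surjective on objects up to isomorphism. *)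

(* Defs.v *)
From Stdlib Require Import List.
Import ListNotations.

Set Implicit Arguments.

Record IntAlg : Type := {
  ia_car :> Type;
  ia_zero : ia_car;
  ia_one : ia_car;
  ia_join : ia_car -> ia_car -> ia_car;
  ia_meet : ia_car -> ia_car -> ia_car;
  ia_compl : ia_car -> ia_car;
  ia_g : ia_car -> ia_car;
  ia_join_assoc : forall x y z, ia_join x (ia_join y z) = ia_join (ia_join x y) z;
  ia_meet_assoc : forall x y z, ia_meet x (ia_meet y z) = ia_meet (ia_meet x y) z;
  ia_join_comm : forall x y, ia_join x y = ia_join y x;
  ia_meet_comm : forall x y, ia_meet x y = ia_meet y x;
  ia_join_absorb : forall x y, ia_join x (ia_meet x y) = x;
  ia_meet_absorb : forall x y, ia_meet x (ia_join x y) = x;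
  ia_distr : forall x y z, ia_meet x (ia_join y z) = ia_join (ia_meet x y) (ia_meet x z);
  ia_join_zero : forall x, ia_join x ia_zero = x;
  ia_meet_one : forall x, ia_meet x ia_one = x;
  ia_compl_join : forall x, ia_join x (ia_compl x) = ia_one;
  ia_compl_meet : forall x, ia_meet x (ia_compl x) = ia_zero;
  ia_g_one : ia_g ia_one = ia_one;
  ia_g_meet : forall x y, ia_g (ia_meet x y) = ia_meet (ia_g x) (ia_g y);
  ia_g_le : forall x, ia_meet (ia_g x) x = ia_g x;
  ia_g_idem : forall x, ia_g (ia_g x) = ia_g x
}.

Definition is_open {A : IntAlg} (x : A) : Prop := ia_g A x = x.

Record IHom (A B : IntAlg) : Type := {
  ih_fun :> A -> B;
  ih_zero : ih_fun (ia_zero A) = ia_zero B;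
  ih_one : ih_fun (ia_one A) = ia_one B;
  ih_join : forall x y, ih_fun (ia_join A x y) = ia_join B (ih_fun x) (ih_fun y);
  ih_meet : forall x y, ih_fun (ia_meet A x y) = ia_meet B (ih_fun x) (ih_fun y);
  ih_compl : forall x, ih_fun (ia_compl A x) = ia_compl B (ih_fun x);
  ih_g : forall x, ih_fun (ia_g A x) = ia_g B (ih_fun x)
}.

Definition ihom_id (A : IntAlg) : IHom A A.
Proof. refine (@Build_IHom A A (fun x => x) _ _ _ _ _ _); reflexivity. Defined.

Definition ihom_comp (A B C : IntAlg) (h1 : IHom A B) (h2 : IHom B C) : IHom A C.
Proof.
  refine (@Build_IHom A C (fun x => h2 (h1 x)) _ _ _ _ _ _); intros;
  rewrite ?ih_zero, ?ih_one, ?ih_join, ?ih_meet, ?ih_compl, ?ih_g; reflexivity.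
Defined.

(* Objects of gamma(V) are isomorphic to some A°, hence are Heyting algebras;
   so only the signature is recorded here. *)
Record HAlg : Type := {
  ha_car :> Type;
  ha_bot : ha_car;
  ha_top : ha_car;
  ha_join : ha_car -> ha_car -> ha_car;
  ha_meet : ha_car -> ha_car -> ha_car;
  ha_imp : ha_car -> ha_car -> ha_car
}.

Record HHom (H K : HAlg) : Type := {
  hh_fun :> H -> K;
  hh_bot : hh_fun (ha_bot H) = ha_bot K;
  hh_top : hh_fun (ha_top H) = ha_top K;
  hh_join : forall x y, hh_fun (ha_join H x y) = ha_join K (hh_fun x) (hh_fun y);
  hh_meet : forall x y, hh_fun (ha_meet H x y) = ha_meet K (hh_fun x) (hh_fun y);
  hh_imp : forall x y, hh_fun (ha_imp H x y) = ha_imp K (hh_fun x) (hh_fun y)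
}.

Definition HIso (H K : HAlg) : Prop :=
  exists (f : HHom H K) (f' : HHom K H),
    (forall x, f' (f x) = x) /\ (forall y, f (f' y) = y).

(* For open a, b we have a /\ b = g(a /\ b), a \/ b = g(a \/ b), 0 = g 0, 1 = g 1,
   so writing the operations with an outer g gives literally the same values
   as the usual operations on A°, while a => b := g(-a + b). *)
Definition open_car (A : IntAlg) : Type := { x : A | is_open x }.

Definition mk_open (A : IntAlg) (x : A) : open_car A :=
  exist _ (ia_g A x) (ia_g_idem A x).

Definition opens (A : IntAlg) : HAlg := {|
  ha_car := open_car A;
  ha_bot := mk_open A (ia_zero A);
  ha_top := mk_open A (ia_one A);
  ha_join := fun a b => mk_open A (ia_join A (proj1_sig a) (proj1_sig b));
  ha_meet := fun a b => mk_open A (ia_meet A (proj1_sig a) (proj1_sig b));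
  ha_imp := fun a b => mk_open A (ia_join A (ia_compl A (proj1_sig a)) (proj1_sig b))
|}.

Inductive term : Type :=
| tVar : nat -> term
| tZero : term
| tOne : term
| tJoin : term -> term -> term
| tMeet : term -> term -> term
| tCompl : term -> term
| tG : term -> term.

Fixpoint eval {A : IntAlg} (v : nat -> A) (t : term) : A :=
  match t with
  | tVar i => v i
  | tZero => ia_zero A
  | tOne => ia_one A
  | tJoin t1 t2 => ia_join A (eval v t1) (eval v t2)
  | tMeet t1 t2 => ia_meet A (eval v t1) (eval v t2)
  | tCompl t1 => ia_compl A (eval v t1)
  | tG t1 => ia_g A (eval v t1)
  end.

Definition satisfies (A : IntAlg) (e : term * term) : Prop :=
  forall v : nat -> A, eval v (fst e) = eval v (snd e).

Definition inV (E : term * term -> Prop) (A : IntAlg) : Prop :=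
  forall e, E e -> satisfies A e.

(* Locally finite: every finitely generated member is finite, i.e. the
   subalgebra generated by any finite list s (= the values of all terms at s)
   is finite. *)
Definition locally_finite (E : term * term -> Prop) : Prop :=
  forall A : IntAlg, inV E A ->
  forall s : list A, exists l : list A,
    forall t : term, In (eval (fun i => nth i s (ia_zero A)) t) l.

(* *-algebra: generated (as an interior algebra) by its open elements. *)
Definition star_algebra (A : IntAlg) : Prop :=
  forall x : A, exists (t : term) (v : nat -> A),
    (forall i, is_open (v i)) /\ eval v t = x.

(* *-variety: V is generated by its *-algebras, i.e. V = HSP(V_star),
   equivalently every equation valid in all *-algebras of V is valid in V. *)
Definition star_variety (E : term * term -> Prop) : Prop :=
  forall e : term * term,
    (forall A : IntAlg, inV E A -> star_algebra A -> satisfies A e) ->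
    forall A : IntAlg, inV E A -> satisfies A e.

Definition O_full (E : term * term -> Prop) : Prop :=
  forall A B : IntAlg, inV E A -> inV E B ->
  forall f : HHom (opens A) (opens B),
    exists h : IHom A B, forall a : opens A, proj1_sig (f a) = h (proj1_sig a).

Definition gammaV (E : term * term -> Prop) (H : HAlg) : Prop :=
  exists A : IntAlg, inV E A /\ HIso H (opens A).

(* Categorical equivalence of V (interior algebra homs) and gamma(V)
   (Heyting algebra homs): a functor V -> gamma(V) that is full, faithful
   and surjective on objects up to isomorphism. *)
Definition cat_equiv (E : term * term -> Prop) : Prop :=
  exists (F : forall A : IntAlg, inV E A -> HAlg)
         (Fm : forall (A B : IntAlg) (hA : inV E A) (hB : inV E B),
                 IHom A B -> HHom (F A hA) (F B hB)),
    (forall A (hA : inV E A), gammaV E (F A hA)) /\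
    (forall A (hA : inV E A) x, Fm A A hA hA (ihom_id A) x = x) /\
    (forall A B C (hA : inV E A) (hB : inV E B) (hC : inV E C)
            (h1 : IHom A B) (h2 : IHom B C) x,
        Fm A C hA hC (ihom_comp h1 h2) x = Fm B C hB hC h2 (Fm A B hA hB h1 x)) /\
    (forall A B (hA : inV E A) (hB : inV E B) (h1 h2 : IHom A B),
        (forall x, Fm A B hA hB h1 x = Fm A B hA hB h2 x) -> forall y, h1 y = h2 y) /\
    (forall A B (hA : inV E A) (hB : inV E B) (f : HHom (F A hA) (F B hB)),
        exists h : IHom A B, forall x, Fm A B hA hB h x = f x) /\
    (forall H : HAlg, gammaV E H -> exists A (hA : inV E A), HIso H (F A hA)).

(* Main.v *)
(* An element of an interior algebra is generated by open elements iff it is a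
   finite meet of clauses [-a + b] with [a], [b] open, because the interior of
   such a meet is the meet of the [a => b].

   Fullness forces every [A] in [V] to be a *-algebra: the identity of the open
   elements lifts to a retraction [A -> A*], which is injective since a
   congruence is determined by the open elements congruent to 1. For local
   finiteness, take the subalgebra generated by a finite [s] and build open
   elements [a_0 <= a_1 <= ...] with only finitely many [x a_i], [x] in the
   subalgebra: [a_{i+1}] is the join of the [g(a_i + e)], where [e] runs over the
   cells of the finite partition given by [s] and the [g(x a_i + -a_i)]. Each
   point outside [a_i] sees a point of the layer [a_{i+1} - a_i], so if 1 were
   never reached, the sum of the even layers up to [N] would alternate [N] times
   along a chain. But the sequence of these sums lies in a power of [A], which is
   a *-algebra, so they all are combinations of a bounded number of open
   elements.

   Conversely, Boolean combinations of open elements satisfy the Grzegorczyk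
   identity, so it holds in every *-variety; in a locally finite variety it makes
   every element a combination of open elements. A Heyting homomorphism [f] then
   extends to the subalgebra of [A x B] generated by its graph, which is again a
   graph. *)

From Stdlib Require Import List Bool Arith Lia Classical ProofIrrelevance.
From Stdlib Require Import FunctionalExtensionality IndefiniteDescription FinFun.
Require Import Defs.
Import ListNotations.

Set Implicit Arguments.

(** * Boolean tautologies *)

Inductive bexp : Type :=
| bVar : nat -> bexp
| bZero : bexp
| bOne : bexp
| bJoin : bexp -> bexp -> bexp
| bMeet : bexp -> bexp -> bexp
| bCompl : bexp -> bexp.

Fixpoint bval (b : nat -> bool) (e : bexp) : bool :=
  match e with
  | bVar i => b i
  | bZero => false
  | bOne => true
  | bJoin e1 e2 => bval b e1 || bval b e2
  | bMeet e1 e2 => bval b e1 && bval b e2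
  | bCompl e1 => negb (bval b e1)
  end.

Fixpoint aval {A : IntAlg} (v : nat -> A) (e : bexp) : A :=
  match e with
  | bVar i => v i
  | bZero => ia_zero A
  | bOne => ia_one A
  | bJoin e1 e2 => ia_join A (aval v e1) (aval v e2)
  | bMeet e1 e2 => ia_meet A (aval v e1) (aval v e2)
  | bCompl e1 => ia_compl A (aval v e1)
  end.

Definition bupd (b : nat -> bool) (n : nat) (c : bool) : nat -> bool :=
  fun i => if Nat.eqb i n then c else b i.

Fixpoint taut (n : nat) (b : nat -> bool) (e : bexp) : bool :=
  match n with
  | 0 => bval b e
  | S n => taut n (bupd b n true) e && taut n (bupd b n false) e
  end.

Section BooleanBasics.

Variable A : IntAlg.
Notation "x ∧ y" := (ia_meet A x y) (at level 40, left associativity).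
Notation "x ∨ y" := (ia_join A x y) (at level 50, left associativity).
Notation "¬ x" := (ia_compl A x) (at level 35, right associativity).
Notation "0" := (ia_zero A).
Notation "1" := (ia_one A).

Lemma meet_idem (x : A) : x ∧ x = x.
Proof. rewrite <- (ia_join_absorb A x x) at 2. apply ia_meet_absorb. Qed.

Lemma meet_zero (x : A) : x ∧ 0 = 0.
Proof.
  rewrite ia_meet_comm, <- (ia_join_zero A x), (ia_join_comm A x).
  apply ia_meet_absorb.
Qed.

Lemma zero_join (x : A) : 0 ∨ x = x.
Proof. rewrite ia_join_comm. apply ia_join_zero. Qed.

Lemma join_one (x : A) : x ∨ 1 = 1.
Proof. rewrite <- (ia_meet_one A x), ia_meet_comm, ia_join_comm. apply ia_join_absorb. Qed.

Lemma meet_meet_distr (p x y : A) : p ∧ (x ∧ y) = (p ∧ x) ∧ (p ∧ y).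
Proof.
  rewrite ia_meet_assoc, <- (meet_idem p) at 1.
  rewrite <- !ia_meet_assoc. f_equal.
  rewrite !ia_meet_assoc. f_equal. apply ia_meet_comm.
Qed.

Lemma meet_compl_meet (p x : A) : p ∧ ¬ (p ∧ x) = p ∧ ¬ x.
Proof.
  assert (E1 : p ∧ ¬ (p ∧ x) ∧ ¬ x = p ∧ ¬ (p ∧ x)).
  { rewrite <- (ia_meet_one A (p ∧ ¬ (p ∧ x))) at 2.
    rewrite <- (ia_compl_join A x), ia_distr.
    rewrite <- (ia_meet_assoc A p _ x), (ia_meet_comm A (¬ _) x), (ia_meet_assoc A p x).
    rewrite ia_compl_meet, zero_join. reflexivity. }
  assert (E2 : p ∧ ¬ x ∧ ¬ (p ∧ x) = p ∧ ¬ x).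
  { rewrite <- (ia_meet_one A (p ∧ ¬ x)) at 2.
    rewrite <- (ia_compl_join A (p ∧ x)), ia_distr.
    rewrite (ia_meet_comm A p x) at 2.
    rewrite <- (ia_meet_assoc A p _ (x ∧ p)), (ia_meet_assoc A _ x p).
    rewrite (ia_meet_comm A (¬ x) x), ia_compl_meet.
    rewrite (ia_meet_comm A 0 p), !meet_zero, zero_join. reflexivity. }
  rewrite <- E1, <- E2.
  rewrite <- !ia_meet_assoc. f_equal. apply ia_meet_comm.
Qed.

(** Meeting with [p] is compatible with every Boolean operation, so evaluation can be carried out
    relative to [p]. *)
Lemma meet_aval (p : A) (v w : nat -> A) (e : bexp) :
  (forall i, p ∧ v i = p ∧ w i) -> p ∧ aval v e = p ∧ aval w e.
Proof.
  intros H; induction e; simpl; auto.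
  - rewrite !ia_distr. congruence.
  - rewrite (meet_meet_distr p (aval v e1)), (meet_meet_distr p (aval w e1)). congruence.
  - rewrite <- meet_compl_meet, IHe, meet_compl_meet. reflexivity.
Qed.

Lemma aval_bool (b : nat -> bool) (e : bexp) :
  aval (fun i => if b i then 1 else 0) e = if bval b e then 1 else 0.
Proof.
  assert (C0 : ¬ 0 = 1) by (rewrite <- (ia_compl_join A 0), zero_join; reflexivity).
  assert (C1 : ¬ 1 = 0)
    by (rewrite <- (ia_compl_meet A 1), ia_meet_comm, ia_meet_one; reflexivity).
  induction e; simpl; auto.
  - rewrite IHe1, IHe2. destruct (bval b e1), (bval b e2); simpl;
      rewrite ?join_one, ?ia_join_zero, ?zero_join; reflexivity.
  - rewrite IHe1, IHe2. destruct (bval b e1), (bval b e2); simpl;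
      rewrite ?ia_meet_one, ?meet_zero; reflexivity.
  - rewrite IHe. destruct (bval b e); simpl; auto.
Qed.

(** Truth tables by relativization: [p] splits into its parts inside and outside [v n], on which
    [v n] acts as 1 and 0. Once all variables are split, [e] takes a constant value relative to
    [p]. *)
Lemma taut_sound_rel (v : nat -> A) (e : bexp) (n : nat) : forall b p,
  taut n b e = true ->
  (forall i, n <= i -> p ∧ v i = p ∧ (if b i then 1 else 0)) ->
  p ∧ aval v e = p.
Proof.
  induction n as [|n IH]; simpl; intros b p Ht Hp.
  - rewrite (meet_aval p v (fun i => if b i then 1 else 0)) by (intros; apply Hp; lia).
    rewrite aval_bool, Ht. apply ia_meet_one.
  - apply andb_prop in Ht as [Ht1 Ht2].
    assert (E : p = p ∧ v n ∨ p ∧ ¬ v n)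
      by (rewrite <- ia_distr, ia_compl_join, ia_meet_one; reflexivity).
    rewrite E at 1. rewrite (ia_meet_comm A _ (aval v e)), ia_distr.
    rewrite !(ia_meet_comm A (aval v e)).
    rewrite (IH _ _ Ht1), (IH _ _ Ht2); [now symmetry| |];
      intros i Hi; unfold bupd; destruct (Nat.eqb_spec i n) as [->|Hne].
    + rewrite <- ia_meet_assoc, (ia_meet_comm A (¬ v n)), ia_compl_meet, !meet_zero.
      reflexivity.
    + rewrite <- !ia_meet_assoc, !(ia_meet_comm A (¬ v n)), !ia_meet_assoc, Hp by lia.
      reflexivity.
    + rewrite <- ia_meet_assoc, meet_idem, ia_meet_one. reflexivity.
    + rewrite <- !ia_meet_assoc, !(ia_meet_comm A (v n)), !ia_meet_assoc, Hp by lia.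
      reflexivity.
Qed.

Lemma taut_sound (l : list A) (e : bexp) :
  taut (length l) (fun _ => false) e = true -> aval (fun i => nth i l 0) e = 1.
Proof.
  intros H. rewrite <- (ia_meet_one A (aval _ e)), ia_meet_comm.
  apply taut_sound_rel with (1 := H).
  (* Beyond the list, [nth] returns 0, in agreement with the constantly false valuation. *)
  intros i Hi. now rewrite nth_overflow.
Qed.

End BooleanBasics.

Definition biff (e f : bexp) : bexp :=
  bMeet (bJoin (bCompl e) f) (bJoin (bCompl f) e).

Fixpoint hyps_hold {A : IntAlg} (v : nat -> A) (hs : list (bexp * bexp)) : Prop :=
  match hs with
  | [] => True
  | (e, f) :: hs => aval v e = aval v f /\ hyps_hold v hs
  end.

Fixpoint entails (hs : list (bexp * bexp)) (c : bexp) : bexp :=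
  match hs with
  | [] => c
  | (e, f) :: hs => bJoin (bCompl (biff e f)) (entails hs c)
  end.

Lemma aval_biff_refl {A : IntAlg} (v : nat -> A) e f :
  aval v e = aval v f -> aval v (biff e f) = ia_one A.
Proof.
  intros H; simpl; rewrite H.
  rewrite (ia_join_comm A (ia_compl A _)), ia_compl_join. apply ia_meet_one.
Qed.

Lemma entails_holds {A : IntAlg} (v : nat -> A) hs c :
  hyps_hold v hs -> aval v (entails hs c) = ia_one A -> aval v c = ia_one A.
Proof.
  induction hs as [|[e f] hs IH]; [easy|].
  intros [H1 H2] H. apply IH; [easy|]. cbn [entails aval] in H.
  rewrite (aval_biff_refl v e f H1) in H.
  rewrite <- (zero_join A (aval v (entails hs c))), <- H. f_equal.
  symmetry. rewrite <- (ia_compl_meet A (ia_one A)) .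
  rewrite (ia_meet_comm A (ia_one A)). now rewrite ia_meet_one.
Qed.

Lemma boolean_entailment (A : IntAlg) (l : list A) hs e f :
  taut (length l) (fun _ => false) (entails hs (biff e f)) = true ->
  hyps_hold (fun i => nth i l (ia_zero A)) hs ->
  aval (fun i => nth i l (ia_zero A)) e = aval (fun i => nth i l (ia_zero A)) f.
Proof.
  intros Ht Hh. apply taut_sound in Ht. apply entails_holds in Ht; [|exact Hh].
  set (v := fun i => nth i l (ia_zero A)) in *. cbn [biff aval] in Ht.
  assert (K : forall x y : A, ia_meet A (ia_join A (ia_compl A x) y)
       (ia_join A (ia_compl A y) x) = ia_one A -> ia_meet A x y = x).
  { intros x y H.
    rewrite <- (ia_meet_one A x) at 2. rewrite <- H.
    rewrite ia_meet_assoc, (ia_distr A x (ia_compl A x) y), ia_compl_meet, zero_join.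
    rewrite (ia_join_comm A _ x), (ia_meet_comm A x y), <- ia_meet_assoc, ia_meet_absorb.
    reflexivity. }
  rewrite <- (K _ _ Ht), ia_meet_comm. apply K. rewrite ia_meet_comm. exact Ht.
Qed.

(** Being an equation, an inequality can serve as hypothesis or goal of the tactic [ba]. *)
Definition le {A : IntAlg} (x y : A) : Prop := ia_meet A x y = x.

(** * Reification of Boolean consequences *)

Ltac ba_mem x l :=
  lazymatch l with
  | nil => false
  | cons x _ => true
  | cons _ ?l' => ba_mem x l'
  end.

Ltac ba_index x l :=
  lazymatch l with
  | cons x _ => constr:(O)
  | cons _ ?l' => let n := ba_index x l' in constr:(S n)
  end.

Ltac ba_atoms A t l :=
  lazymatch t with
  | ia_zero _ => l
  | ia_one _ => l
  | ia_join _ ?x ?y => let l := ba_atoms A x l in ba_atoms A y l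
  | ia_meet _ ?x ?y => let l := ba_atoms A x l in ba_atoms A y l
  | ia_compl _ ?x => ba_atoms A x l
  | _ => lazymatch ba_mem t l with
         | true => l
         | false => constr:(@cons (ia_car A) t l)
         end
  end.

Ltac ba_reify t l :=
  lazymatch t with
  | ia_zero _ => constr:(bZero)
  | ia_one _ => constr:(bOne)
  | ia_join _ ?x ?y =>
      let x := ba_reify x l in let y := ba_reify y l in constr:(bJoin x y)
  | ia_meet _ ?x ?y =>
      let x := ba_reify x l in let y := ba_reify y l in constr:(bMeet x y)
  | ia_compl _ ?x => let x := ba_reify x l in constr:(bCompl x)
  | _ => let n := ba_index t l in constr:(bVar n)
  end.

Ltac ba_goal_atoms A G l :=
  lazymatch G with
  | (@eq _ ?x ?y) -> ?G' =>
      let l := ba_atoms A x l in let l := ba_atoms A y l in ba_goal_atoms A G' l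
  | @eq _ ?x ?y => let l := ba_atoms A x l in ba_atoms A y l
  end.

Ltac ba_goal_hyps G l :=
  lazymatch G with
  | (@eq _ ?x ?y) -> ?G' =>
      let x := ba_reify x l in let y := ba_reify y l in
      let hs := ba_goal_hyps G' l in constr:(cons (x, y) hs)
  | _ => constr:(@nil (bexp * bexp))
  end.

Ltac ba_goal_concl G l :=
  lazymatch G with
  | (@eq _ ?x ?y) -> ?G' => ba_goal_concl G' l
  | @eq _ ?x ?y =>
      let x := ba_reify x l in let y := ba_reify y l in constr:((x, y))
  end.

(* Proves an equation or inequality of [A] that is a Boolean consequence of
   the equations and inequalities of [A] in the context, interior terms being
   treated as variables. *)
Ltac ba :=
  intros; unfold le, is_open in *;
  lazymatch goal with
  | |- @eq (ia_car ?A) _ _ =>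
    repeat match goal with
    | H : @eq (ia_car A) _ _ |- _ => revert H
    end;
    lazymatch goal with
    | |- ?G =>
      let l := ba_goal_atoms A G (@nil (ia_car A)) in
      let hs := ba_goal_hyps G l in
      let c := ba_goal_concl G l in
      lazymatch c with
      | (?e, ?f) =>
        intros;
        apply (@boolean_entailment A l hs e f);
        [ vm_compute; reflexivity
        | repeat (split; [assumption|]); exact I ]
      end
    end
  end.

(** * Interior algebras: order, subalgebras, products *)

Lemma le_antisym (A : IntAlg) (x y : A) : le x y -> le y x -> x = y.
Proof. ba. Qed.

Lemma le_trans (A : IntAlg) (x y z : A) : le x y -> le y z -> le x z.
Proof. ba. Qed.

Lemma g_le (A : IntAlg) (x : A) : le (ia_g A x) x.
Proof. apply ia_g_le. Qed.

Lemma g_open (A : IntAlg) (x : A) : is_open (ia_g A x).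
Proof. apply ia_g_idem. Qed.

Lemma g_mono (A : IntAlg) (x y : A) : le x y -> le (ia_g A x) (ia_g A y).
Proof. unfold le; intros H. now rewrite <- ia_g_meet, H. Qed.

Lemma open_le_g (A : IntAlg) (z x : A) : is_open z -> le z x -> le z (ia_g A x).
Proof. intros Hz Hl. rewrite <- Hz. now apply g_mono. Qed.

Lemma open_zero (A : IntAlg) : is_open (ia_zero A).
Proof. pose proof (g_le A (ia_zero A)). ba. Qed.

Lemma open_one (A : IntAlg) : is_open (ia_one A).
Proof. apply ia_g_one. Qed.

Lemma open_meet (A : IntAlg) (x y : A) :
  is_open x -> is_open y -> is_open (ia_meet A x y).
Proof. unfold is_open; intros Hx Hy. now rewrite ia_g_meet, Hx, Hy. Qed.

Lemma open_join (A : IntAlg) (x y : A) :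
  is_open x -> is_open y -> is_open (ia_join A x y).
Proof.
  intros Hx Hy. pose proof (g_le A (ia_join A x y)).
  assert (le x (ia_g A (ia_join A x y))) by (apply open_le_g; [easy|ba]).
  assert (le y (ia_g A (ia_join A x y))) by (apply open_le_g; [easy|ba]).
  ba.
Qed.

Record subuniverse {A : IntAlg} (P : A -> Prop) : Prop := {
  sub_zero : P (ia_zero A);
  sub_one : P (ia_one A);
  sub_join : forall x y, P x -> P y -> P (ia_join A x y);
  sub_meet : forall x y, P x -> P y -> P (ia_meet A x y);
  sub_compl : forall x, P x -> P (ia_compl A x);
  sub_g : forall x, P x -> P (ia_g A x)
}.

Lemma subuniverse_eval (A : IntAlg) (P : A -> Prop) (v : nat -> A) (t : term) :
  subuniverse P -> (forall i, P (v i)) -> P (eval v t).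
Proof. intros [] Hv; induction t; simpl; auto. Qed.

Lemma sig_eq (T : Type) (P : T -> Prop) (x y : {a | P a}) :
  proj1_sig x = proj1_sig y -> x = y.
Proof. apply eq_sig_hprop. intros; apply proof_irrelevance. Qed.

Definition sub_alg (A : IntAlg) (P : A -> Prop) (HP : subuniverse P) : IntAlg.
Proof.
  refine {|
    ia_car := {x : A | P x};
    ia_zero := exist _ (ia_zero A) (sub_zero HP);
    ia_one := exist _ (ia_one A) (sub_one HP);
    ia_join := fun x y => exist _ (ia_join A (proj1_sig x) (proj1_sig y))
                 (sub_join HP _ _ (proj2_sig x) (proj2_sig y));
    ia_meet := fun x y => exist _ (ia_meet A (proj1_sig x) (proj1_sig y))
                 (sub_meet HP _ _ (proj2_sig x) (proj2_sig y));
    ia_compl := fun x => exist _ (ia_compl A (proj1_sig x))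
                  (sub_compl HP _ (proj2_sig x));
    ia_g := fun x => exist _ (ia_g A (proj1_sig x)) (sub_g HP _ (proj2_sig x))
  |}; intros; apply sig_eq; simpl;
  [ apply ia_join_assoc | apply ia_meet_assoc | apply ia_join_comm
  | apply ia_meet_comm | apply ia_join_absorb | apply ia_meet_absorb
  | apply ia_distr | apply ia_join_zero | apply ia_meet_one
  | apply ia_compl_join | apply ia_compl_meet | apply ia_g_one
  | apply ia_g_meet | apply ia_g_le | apply ia_g_idem ].
Defined.

Lemma eval_sub_alg (A : IntAlg) (P : A -> Prop) (HP : subuniverse P)
    (v : nat -> sub_alg HP) (t : term) :
  proj1_sig (eval v t) = eval (fun i => proj1_sig (v i)) t.
Proof. induction t; simpl; congruence. Qed.

Lemma inV_sub_alg E (A : IntAlg) (P : A -> Prop) (HP : subuniverse P) :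
  inV E A -> inV E (sub_alg HP).
Proof.
  intros HA e He v. apply sig_eq. rewrite !eval_sub_alg. now apply HA.
Qed.

Definition sub_incl (A : IntAlg) (P : A -> Prop) (HP : subuniverse P) :
  IHom (sub_alg HP) A.
Proof. refine (@Build_IHom (sub_alg HP) A (@proj1_sig _ _) _ _ _ _ _ _); reflexivity. Defined.

Definition power_alg (I : Type) (A : IntAlg) : IntAlg.
Proof.
  refine {|
    ia_car := I -> A;
    ia_zero := fun _ => ia_zero A;
    ia_one := fun _ => ia_one A;
    ia_join := fun x y i => ia_join A (x i) (y i);
    ia_meet := fun x y i => ia_meet A (x i) (y i);
    ia_compl := fun x i => ia_compl A (x i);
    ia_g := fun x i => ia_g A (x i)
  |}; intros; apply functional_extensionality; intro;
  [ apply ia_join_assoc | apply ia_meet_assoc | apply ia_join_comm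
  | apply ia_meet_comm | apply ia_join_absorb | apply ia_meet_absorb
  | apply ia_distr | apply ia_join_zero | apply ia_meet_one
  | apply ia_compl_join | apply ia_compl_meet | apply ia_g_one
  | apply ia_g_meet | apply ia_g_le | apply ia_g_idem ].
Defined.

Lemma eval_power_alg (I : Type) (A : IntAlg) (v : nat -> power_alg I A) (t : term) i :
  eval v t i = eval (fun n => v n i) t.
Proof. induction t; simpl; congruence. Qed.

Lemma inV_power_alg E (I : Type) (A : IntAlg) : inV E A -> inV E (power_alg I A).
Proof.
  intros HA e He v. apply functional_extensionality; intro i.
  rewrite !eval_power_alg. now apply HA.
Qed.

Definition prod_alg (A B : IntAlg) : IntAlg.
Proof.
  refine {|
    ia_car := A * B;
    ia_zero := (ia_zero A, ia_zero B);
    ia_one := (ia_one A, ia_one B);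
    ia_join := fun p q => (ia_join A (fst p) (fst q), ia_join B (snd p) (snd q));
    ia_meet := fun p q => (ia_meet A (fst p) (fst q), ia_meet B (snd p) (snd q));
    ia_compl := fun p => (ia_compl A (fst p), ia_compl B (snd p));
    ia_g := fun p => (ia_g A (fst p), ia_g B (snd p))
  |}; intros; apply injective_projections; simpl;
  first [ apply ia_join_assoc | apply ia_meet_assoc | apply ia_join_comm
  | apply ia_meet_comm | apply ia_join_absorb | apply ia_meet_absorb
  | apply ia_distr | apply ia_join_zero | apply ia_meet_one
  | apply ia_compl_join | apply ia_compl_meet | apply ia_g_one
  | apply ia_g_meet | apply ia_g_le | apply ia_g_idem ].
Defined.

(** * Boolean combinations of open elements *)

(** Two elements per clause suffice when [L] is closed under meets and joins: negative literals
    merge into [a], positive ones into [b]. *)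
Inductive cnf {A : IntAlg} (L : A -> Prop) : A -> Prop :=
| cnf_one : cnf L (ia_one A)
| cnf_cons a b x : L a -> L b -> cnf L x ->
    cnf L (ia_meet A (ia_join A (ia_compl A a) b) x).

(** Stated for a subset because it is applied both to all open elements of an algebra and to the
    graph of a Heyting homomorphism inside a product. *)
Record heyting_subset {A : IntAlg} (L : A -> Prop) : Prop := {
  hs_zero : L (ia_zero A);
  hs_one : L (ia_one A);
  hs_join : forall a b, L a -> L b -> L (ia_join A a b);
  hs_meet : forall a b, L a -> L b -> L (ia_meet A a b);
  hs_imp : forall a b, L a -> L b -> L (ia_g A (ia_join A (ia_compl A a) b))
}.

Lemma heyting_subset_open (A : IntAlg) : heyting_subset (@is_open A).
Proof.
  split; auto using open_zero, open_one, open_join, open_meet, g_open.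
Qed.

Section CNF.

Variables (A : IntAlg) (L : A -> Prop).
Hypothesis HL : heyting_subset L.

Lemma cnf_clause a b : L a -> L b -> cnf L (ia_join A (ia_compl A a) b).
Proof.
  intros Ha Hb. rewrite <- (ia_meet_one A). now repeat constructor.
Qed.

Lemma cnf_incl a : L a -> cnf L a.
Proof.
  intros Ha. replace a with (ia_join A (ia_compl A (ia_one A)) a) by ba.
  apply cnf_clause; [apply HL|easy].
Qed.

Lemma cnf_meet x y : cnf L x -> cnf L y -> cnf L (ia_meet A x y).
Proof.
  intros Hx Hy; induction Hx as [|a b x Ha Hb Hx IH].
  - now replace (ia_meet A (ia_one A) y) with y by ba.
  - rewrite <- ia_meet_assoc. now constructor.
Qed.

Lemma cnf_join_clause a b x :
  L a -> L b -> cnf L x -> cnf L (ia_join A (ia_join A (ia_compl A a) b) x).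
Proof.
  intros Ha Hb Hx; induction Hx as [|a' b' x Ha' Hb' Hx IH].
  - rewrite join_one. constructor.
  - replace (ia_join _ _ _) with
      (ia_meet A (ia_join A (ia_compl A (ia_meet A a a')) (ia_join A b b'))
         (ia_join A (ia_join A (ia_compl A a) b) x)) by ba.
    constructor; auto; now apply HL.
Qed.

Lemma cnf_join x y : cnf L x -> cnf L y -> cnf L (ia_join A x y).
Proof.
  intros Hx Hy; induction Hx as [|a b x Ha Hb Hx IH].
  - replace (ia_join _ _ _) with (ia_one A) by ba. constructor.
  - replace (ia_join _ _ _) with
      (ia_meet A (ia_join A (ia_join A (ia_compl A a) b) y) (ia_join A x y)) by ba.
    apply cnf_meet; auto using cnf_join_clause.
Qed.

Lemma cnf_compl x : cnf L x -> cnf L (ia_compl A x).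
Proof.
  intros Hx; induction Hx as [|a b x Ha Hb Hx IH].
  - replace (ia_compl _ _) with (ia_zero A) by ba. apply cnf_incl, HL.
  - replace (ia_compl A (ia_meet _ _ _)) with
      (ia_join A (ia_meet A a (ia_join A (ia_compl A b) (ia_zero A))) (ia_compl A x)) by ba.
    apply cnf_join; [|easy].
    apply cnf_meet; [now apply cnf_incl|apply cnf_clause; [easy|apply HL]].
Qed.

(* The interior of a meet of clauses [-a + b] is the meet of the [a => b]. *)
Lemma cnf_g x : cnf L x -> L (ia_g A x).
Proof.
  intros Hx; induction Hx as [|a b x Ha Hb Hx IH].
  - rewrite ia_g_one. apply HL.
  - rewrite ia_g_meet. apply HL; [now apply HL|easy].
Qed.

Lemma cnf_subuniverse : subuniverse (cnf L).
Proof.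
  split; auto using cnf_join, cnf_meet, cnf_compl, cnf_incl, cnf_g, cnf_one.
  apply cnf_incl, HL.
Qed.

End CNF.

Fixpoint shift2 (t : term) : term :=
  match t with
  | tVar i => tVar (S (S i))
  | tZero => tZero
  | tOne => tOne
  | tJoin t1 t2 => tJoin (shift2 t1) (shift2 t2)
  | tMeet t1 t2 => tMeet (shift2 t1) (shift2 t2)
  | tCompl t1 => tCompl (shift2 t1)
  | tG t1 => tG (shift2 t1)
  end.

Lemma eval_shift2 (A : IntAlg) (v : nat -> A) (t : term) :
  eval v (shift2 t) = eval (fun i => v (S (S i))) t.
Proof. induction t; simpl; congruence. Qed.

(** The normal forms over the open elements are a subalgebra containing these. Conversely, each
    clause is a term in two fresh variables, for which [shift2] makes room. *)
Lemma star_algebra_cnf (A : IntAlg) :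
  star_algebra A <-> forall x : A, cnf is_open x.
Proof.
  split.
  - intros HA x. destruct (HA x) as (t & v & Hv & <-).
    pose proof (heyting_subset_open A) as HL.
    apply subuniverse_eval; [now apply cnf_subuniverse|].
    intros i. now apply cnf_incl.
  - intros HA x. induction (HA x) as [|a b x Ha Hb _ (t & v & Hv & <-)].
    + exists tOne, (fun _ => ia_one A). split; [intros; apply open_one|easy].
    + exists (tMeet (tJoin (tCompl (tVar 0)) (tVar 1)) (shift2 t)),
        (fun n => match n with 0 => a | 1 => b | S (S n) => v n end).
      split.
      * intros [|[|i]]; auto.
      * simpl. now rewrite eval_shift2.
Qed.

Lemma ihom_agree_cnf (A B : IntAlg) (h1 h2 : IHom A B) (x : A) :
  (forall a, is_open a -> h1 a = h2 a) -> cnf is_open x -> h1 x = h2 x.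
Proof.
  intros H Hx; induction Hx as [|a b x Ha Hb Hx IH].
  - now rewrite !ih_one.
  - rewrite !ih_meet, !ih_join, !ih_compl, IH, (H a), (H b); auto.
Qed.

(** * Extending Heyting homomorphisms *)

Section Extension.

Variables (A B : IntAlg) (f : HHom (opens A) (opens B)).
Hypothesis HA : forall x : A, cnf is_open x.

Let op (a : opens A) : A := proj1_sig a.
Let im (a : opens A) : B := proj1_sig (f a).

Let op_open a : is_open (op a).
Proof. apply (proj2_sig a). Qed.

Let im_open a : is_open (im a).
Proof. apply (proj2_sig (f a)). Qed.

(** The operations of [opens] carry an outer interior; here and in the next three lemmas it
    disappears because its argument is already open. *)
Lemma hhom_im_zero : im (ha_bot (opens A)) = ia_zero B.
Proof. unfold im. rewrite hh_bot. apply open_zero. Qed.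

Lemma hhom_im_one : im (ha_top (opens A)) = ia_one B.
Proof. unfold im. rewrite hh_top. apply open_one. Qed.

Lemma hhom_im_join a b : im (ha_join (opens A) a b) = ia_join B (im a) (im b).
Proof. unfold im. rewrite hh_join. apply open_join; apply im_open. Qed.

Lemma hhom_im_meet a b : im (ha_meet (opens A) a b) = ia_meet B (im a) (im b).
Proof. unfold im. rewrite hh_meet. apply open_meet; apply im_open. Qed.

Lemma hhom_im_imp a b :
  im (ha_imp (opens A) a b) = ia_g B (ia_join B (ia_compl B (im a)) (im b)).
Proof. unfold im. now rewrite hh_imp. Qed.

Definition graph (p : prod_alg A B) : Prop := exists a, p = (op a, im a).

Lemma graph_intro (a : opens A) x y : op a = x -> im a = y -> graph (x, y).
Proof. intros <- <-. now exists a. Qed.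

Lemma heyting_subset_graph : heyting_subset graph.
Proof.
  split.
  - apply graph_intro with (ha_bot (opens A)); [apply open_zero|apply hhom_im_zero].
  - apply graph_intro with (ha_top (opens A)); [apply open_one|apply hhom_im_one].
  - intros p q [a ->] [b ->]. apply graph_intro with (ha_join (opens A) a b);
      [apply open_join; apply op_open|apply hhom_im_join].
  - intros p q [a ->] [b ->]. apply graph_intro with (ha_meet (opens A) a b);
      [apply open_meet; apply op_open|apply hhom_im_meet].
  - intros p q [a ->] [b ->]. apply graph_intro with (ha_imp (opens A) a b);
      [easy|apply hhom_im_imp].
Qed.

Lemma cnf_graph_total x : exists y, cnf graph (x, y).
Proof.
  induction (HA x) as [|a b x Ha Hb _ [y Hy]].
  - exists (ia_one B). exact (cnf_one graph).
  - exists (ia_meet B (ia_join B (ia_compl B (im (exist _ a Ha))) (im (exist _ b Hb))) y).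
    apply (@cnf_cons (prod_alg A B) graph (a, im (exist _ a Ha)) (b, im (exist _ b Hb)) (x, y));
      [now exists (exist _ a Ha)|now exists (exist _ b Hb)|easy].
Qed.

(* [(-a + b) m c <= d] holds iff [m c <= d + a] and [m (b c) <= d]: this
   eliminates the clauses of [p] one by one until only the lattice order on
   open elements is left. *)
Lemma cnf_graph_le p : cnf graph p -> forall c d,
  le (ia_meet A (fst p) (op c)) (op d) -> le (ia_meet B (snd p) (im c)) (im d).
Proof.
  intros Hp; induction Hp as [|p q r [a ->] [b ->] Hr IH]; intros c d Hcd; simpl in *.
  (* No clause is left: [c] is below [d], an equation between open elements that [f] preserves. *)
  - assert (E : ha_meet (opens A) c d = c).
    { apply sig_eq. simpl. rewrite open_meet by apply op_open.
      fold (op c) (op d). ba. }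
    pose proof (hhom_im_meet c d) as E2. rewrite E in E2. ba.
  - assert (H1 := IH c (ha_join (opens A) d a)).
    assert (H2 := IH (ha_meet (opens A) c b) d).
    rewrite hhom_im_join in H1. rewrite hhom_im_meet in H2.
    assert (E1 : op (ha_join (opens A) d a) = ia_join A (op d) (op a))
      by (apply open_join; apply op_open).
    assert (E2 : op (ha_meet (opens A) c b) = ia_meet A (op c) (op b))
      by (apply open_meet; apply op_open).
    assert (G1 : le (ia_meet A (fst r) (op c)) (op (ha_join (opens A) d a)))
      by (rewrite E1; clear -Hcd; ba).
    assert (G2 : le (ia_meet A (fst r) (op (ha_meet (opens A) c b))) (op d))
      by (rewrite E2; clear -Hcd; ba).
    specialize (H1 G1). specialize (H2 G2). clear -H1 H2. ba.
Qed.

(** The generated subalgebra also contains the pair of [x] minus [x], which is 0, and [z] minus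
    [z']. Taking top for [c] and bottom for [d] in [cnf_graph_le] makes the second component
    vanish. *)
Lemma cnf_graph_functional x y y' : cnf graph (x, y) -> cnf graph (x, y') -> y = y'.
Proof.
  pose proof heyting_subset_graph as HL.
  assert (K : forall z z', cnf graph (x, z) -> cnf graph (x, z') -> le z z').
  { intros z z' Hz Hz'.
    pose proof (cnf_meet Hz (cnf_compl HL Hz')) as H.
    pose proof (cnf_graph_le H (ha_top (opens A)) (ha_bot (opens A))) as Hle.
    rewrite hhom_im_one, hhom_im_zero in Hle.
    assert (E : op (ha_bot (opens A)) = ia_zero A) by apply open_zero.
    assert (Hle' : le (ia_meet B (ia_meet B z (ia_compl B z')) (ia_one B)) (ia_zero B)).
    { apply Hle. rewrite E. change (fst _) with (ia_meet A x (ia_compl A x)). clear; ba. }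
    clear -Hle'. ba. }
  intros Hy Hy'. apply le_antisym; auto.
Qed.

Lemma hhom_extension : exists h : IHom A B, forall a : opens A, im a = h (op a).
Proof.
  destruct (functional_choice _ cnf_graph_total) as [h Hh].
  assert (HS : subuniverse (cnf graph)) by (apply cnf_subuniverse, heyting_subset_graph).
  assert (K : forall x y, cnf graph (x, y) -> h x = y)
    by (intros x y Hy; eapply cnf_graph_functional; eauto).
  unshelve eexists (@Build_IHom A B h _ _ _ _ _ _).
  - apply K, (sub_zero HS).
  - apply K, (sub_one HS).
  - intros x y. apply K, (sub_join HS _ _ (Hh x) (Hh y)).
  - intros x y. apply K, (sub_meet HS _ _ (Hh x) (Hh y)).
  - intros x. apply K, (sub_compl HS _ (Hh x)).
  - intros x. apply K, (sub_g HS _ (Hh x)).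
  - intros a. symmetry. apply K, cnf_incl; [apply heyting_subset_graph|now exists a].
Qed.

End Extension.

(** * Fullness makes every member a *-algebra *)

(** If [k x = 1], then [g x = k (g x) = g (k x) = 1], so [x = 1]. Applied to the biconditional of
    [x] and [y], this gives injectivity. *)
Lemma ihom_fixing_opens_inj (A : IntAlg) (k : IHom A A) :
  (forall a, is_open a -> k a = a) -> forall x y, k x = k y -> x = y.
Proof.
  intros Hk.
  assert (K : forall x, k x = ia_one A -> x = ia_one A).
  { intros x Hx. pose proof (ih_g k x) as E. rewrite Hx, ia_g_one in E.
    rewrite (Hk _ (g_open A x)) in E. pose proof (g_le A x). clear Hx. ba. }
  intros x y Hxy.
  pose proof (K (ia_meet A (ia_join A (ia_compl A x) y) (ia_join A (ia_compl A y) x))) as E.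
  rewrite ih_meet, !ih_join, !ih_compl, Hxy in E.
  assert (E' := E ltac:(clear; ba)). clear -E'. ba.
Qed.

Lemma O_full_cnf E : O_full E ->
  forall A : IntAlg, inV E A -> forall x : A, cnf is_open x.
Proof.
  intros HF A HA.
  pose proof (heyting_subset_open A) as HL.
  set (HS := cnf_subuniverse HL).
  set (i := fun a : opens A =>
    exist (@is_open (sub_alg HS))
      (exist (cnf is_open) (proj1_sig a) (cnf_incl HL _ (proj2_sig a)))
      (@sig_eq _ _ (ia_g (sub_alg HS) (exist _ _ _)) (exist _ _ _) (proj2_sig a)) : opens (sub_alg HS)).
  assert (Hf : exists f : HHom (opens A) (opens (sub_alg HS)), forall a, f a = i a).
  { unshelve eexists (@Build_HHom _ _ i _ _ _ _ _); [..|easy];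
      intros; apply sig_eq, sig_eq; reflexivity. }
  destruct Hf as [f Hf].
  destruct (HF _ _ HA (@inV_sub_alg _ _ _ HS HA) f) as [h Hh].
  set (k := ihom_comp h (sub_incl HS)).
  assert (Hk : forall a, is_open a -> k a = a).
  { intros a Ha. pose proof (Hh (exist _ a Ha)) as H. rewrite Hf in H.
    symmetry. exact (f_equal (@proj1_sig _ _) H). }
  assert (Hc : forall x, cnf is_open (k x)) by (intros x; apply (proj2_sig (h x))).
  intros x. replace x with (k x); [apply Hc|].
  (* It remains to see [k (k x) = k x]: the element [k x] is a combination of open elements, all
     fixed by [k]. *)
  apply (ihom_fixing_opens_inj k Hk).
  apply (ihom_agree_cnf k (ihom_id A)); auto.
Qed.

(** * Open elements deciding a Boolean combination *)

Definition decides {A : IntAlg} (q y : A) : Prop := le q y \/ le q (ia_compl A y).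

(** A semantic substitute for [x] being a Boolean combination of [U], independent of the shape of
    the combination. *)
Definition decided_by {A : IntAlg} (U : list A) (x : A) : Prop :=
  forall q, (forall u, In u U -> decides q u) -> decides q x.

Lemma decides_compl (A : IntAlg) (q x : A) : decides q x -> decides q (ia_compl A x).
Proof. intros [H|H]; [right|left]; ba. Qed.

Lemma decides_join (A : IntAlg) (q x y : A) :
  decides q x -> decides q y -> decides q (ia_join A x y).
Proof. intros [H|H] [K|K]; [left|left|left|right]; ba. Qed.

Lemma decides_meet (A : IntAlg) (q x y : A) :
  decides q x -> decides q y -> decides q (ia_meet A x y).
Proof. intros [H|H] [K|K]; [left|right|right|right]; ba. Qed.

Lemma decides_le (A : IntAlg) (p q x : A) : le p q -> decides q x -> decides p x.
Proof. intros Hl [H|H]; [left|right]; ba. Qed.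

Lemma decided_by_one (A : IntAlg) : decided_by [] (ia_one A).
Proof. intros q _. left. ba. Qed.

Lemma decided_by_clause (A : IntAlg) (U : list A) (a b x : A) :
  decided_by U x ->
  decided_by (a :: b :: U) (ia_meet A (ia_join A (ia_compl A a) b) x).
Proof.
  intros H q Hq. apply decides_meet; [apply decides_join|].
  - apply decides_compl, Hq; now left.
  - apply Hq; now right; left.
  - apply H. intros u Hu. apply Hq. now right; right.
Qed.

Lemma cnf_decided (A : IntAlg) (x : A) : cnf is_open x ->
  exists U, (forall u, In u U -> is_open u) /\ decided_by U x.
Proof.
  intros Hx; induction Hx as [|a b x Ha Hb Hx (U & HU & Hd)].
  - exists []. split; [easy|apply decided_by_one].
  - exists (a :: b :: U). split; [|now apply decided_by_clause].
    intros u [<-|[<-|Hu]]; auto.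
Qed.

(* Boolean combinations in a power use, in every coordinate, the same number
   of open elements. *)
Lemma cnf_power_decided (I : Type) (A : IntAlg) (x : power_alg I A) : cnf is_open x ->
  exists n, forall i, exists U,
    length U = n /\ (forall u, In u U -> is_open u) /\ decided_by U (x i).
Proof.
  intros Hx; induction Hx as [|a b x Ha Hb Hx (n & IH)].
  - exists 0. intros i. exists []. repeat split; [easy|apply decided_by_one].
  - exists (S (S n)). intros i. destruct (IH i) as (U & Hn & HU & Hd).
    exists (a i :: b i :: U). repeat split.
    + simpl. congruence.
    + intros u [<-|[<-|Hu]]; [exact (equal_f Ha i)|exact (equal_f Hb i)|auto].
    + now apply decided_by_clause.
Qed.

(** A pointfree choice of a point of [y] in [z] with a small neighbourhood: [z] is cut down by each
    [u] in turn, unless this would lose all of [y]. *)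
Lemma open_refine (A : IntAlg) (U : list A) (z y : A) :
  (forall u, In u U -> is_open u) -> is_open z -> ia_meet A z y <> ia_zero A ->
  exists z', is_open z' /\ le z' z /\ ia_meet A z' y <> ia_zero A /\
    forall u, In u U -> le z' u \/ ia_meet A (ia_meet A z' y) u = ia_zero A.
Proof.
  intros HU Hz Hzy. induction U as [|u U IH].
  - exists z. repeat split; auto; [ba|easy].
  - destruct IH as (z' & Hz' & Hle & Hne & Hd); [intros; apply HU; now right|].
    destruct (classic (ia_meet A (ia_meet A z' y) u = ia_zero A)) as [H0|H0].
    + exists z'. repeat split; auto. intros w [<-|Hw]; auto.
    + exists (ia_meet A z' u). repeat split.
      * apply open_meet; [easy|apply HU; now left].
      * clear -Hle. ba.
      * intros E. apply H0. clear -E. ba.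
      * intros w [<-|Hw]; [left; clear; ba|].
        destruct (Hd w Hw) as [H|H]; [left|right]; clear -H; ba.
Qed.

(** * The Grzegorczyk identity *)

(** With [g] read as a box, [grz] is the modal axiom □(□(p → □p) → p) → p, stated as an
    inequality. *)
Definition grz_term : term :=
  tG (tJoin (tCompl (tG (tJoin (tCompl (tVar 0)) (tG (tVar 0))))) (tVar 0)).

Definition grz : term * term := (tMeet grz_term (tVar 0), grz_term).

(* If the identity fails, shrink the left-hand side to an open [z'] on which
   the part outside [x] decides the open elements [U] generating [x]. Then
   [z' x -gx] decides [U] in the same way, so that it must vanish. *)
Lemma grz_of_cnf (A : IntAlg) (x : A) : cnf is_open x ->
  le (ia_g A (ia_join A (ia_compl A (ia_g A (ia_join A (ia_compl A x) (ia_g A x)))) x)) x.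
Proof.
  intros Hx. destruct (cnf_decided Hx) as (U & HU & Hd).
  set (w := ia_g A (ia_join A (ia_compl A x) (ia_g A x))).
  set (z := ia_g A (ia_join A (ia_compl A w) x)).
  apply NNPP; intros Hn.
  destruct (@open_refine A U z (ia_compl A x) HU) as (z' & Hz' & Hle & Hne & Hz).
  { apply g_open. }
  { intros E. apply Hn. clear -E. ba. }
  set (p := ia_meet A z' (ia_meet A x (ia_compl A (ia_g A x)))).
  set (q := ia_meet A z' (ia_compl A x)).
  assert (Hpq : decides (ia_join A p q) x).
  { apply Hd. intros u Hu. destruct (Hz u Hu) as [H|H].
    - left. clear -H. subst p q. ba.
    - right.
      (* An open element below [x] is below [g x], and [p] lies outside [g x]; so [p] misses [u], as
         [q] does. *)
      assert (H1 : le (ia_meet A z' u) (ia_g A x)).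
      { apply open_le_g; [apply open_meet; auto|]. clear -H. ba. }
      pose proof (g_le A x) as H2. clear -H H1 H2. subst p q. ba. }
  destruct Hpq as [H|H].
  { apply Hne. clear -H. subst p q. ba. }
  assert (H1 : le z' w).
  { apply open_le_g; [easy|]. clear -H. subst p q. ba. }
  assert (H2 : le z (ia_join A (ia_compl A w) x)) by apply g_le.
  apply Hne. clear -H1 H2 Hle. ba.
Qed.

Lemma not_injective_finite (T : Type) (a : nat -> T) (l : list T) :
  (forall i, In (a i) l) -> exists i j, i < j /\ a i = a j.
Proof.
  intros Hl. apply NNPP; intros Hn.
  assert (Hinj : Injective a).
  { intros i j Hij. destruct (Nat.lt_total i j) as [H|[H|H]]; auto;
      exfalso; apply Hn; eauto. }
  pose proof (Injective_map_NoDup Hinj (seq_NoDup (S (length l)) 0)) as Hnd.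
  apply NoDup_incl_length with (l' := l) in Hnd.
  - rewrite length_map, length_seq in Hnd. lia.
  - intros y Hy. apply in_map_iff in Hy as (i & <- & _). apply Hl.
Qed.

(* Interprets the increasing sequence [a_0 = 0], [a_{i+1} = g(a_i + x) + g(a_i - x)]
   at the variable [x]. *)
Fixpoint layer_term (n : nat) : term :=
  match n with
  | 0 => tZero
  | S n => tJoin (tG (tJoin (layer_term n) (tVar 0)))
                 (tG (tJoin (layer_term n) (tCompl (tVar 0))))
  end.

(** By finiteness the sequence [a] stops at some [c], with [g(c + x) = c = g(c - x)]. The
    Grzegorczyk identity at [c + x] then forces [c = 1], while every [x a_n] is a combination of
    open elements. *)
Lemma cnf_of_grz (A : IntAlg) (x : A) (l : list A) :
  satisfies A grz ->
  (forall t, In (eval (fun i => nth i [x] (ia_zero A)) t) l) ->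
  cnf is_open x.
Proof.
  intros Hgrz Hl. set (v := fun i => nth i [x] (ia_zero A)) in *.
  pose proof (heyting_subset_open A) as HL.
  set (a := fun n => eval v (layer_term n)).
  assert (aS : forall n, a (S n) = ia_join A (ia_g A (ia_join A (a n) x))
                                             (ia_g A (ia_join A (a n) (ia_compl A x))))
    by reflexivity.
  assert (aopen : forall n, is_open (a n)).
  { intros [|n]; [apply open_zero|]. rewrite aS. apply open_join; apply g_open. }
  assert (amono1 : forall n, le (a n) (a (S n))).
  { intros n. rewrite aS.
    assert (H : le (a n) (ia_g A (ia_join A (a n) x))) by (apply open_le_g; [easy|ba]).
    clear -H. ba. }
  assert (amono : forall i j, i <= j -> le (a i) (a j)).
  { intros i j Hij; induction Hij as [|j Hij IH]; [ba|]. eapply le_trans; eauto. }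
  assert (acnf : forall n, cnf is_open (ia_meet A x (a n))).
  { intros n; induction n as [|n IH].
    - replace (ia_meet A x (a 0)) with (ia_zero A) by (change (a 0) with (ia_zero A); ba).
      apply (cnf_incl HL), open_zero.
    (* Outside [a n], the first summand of [a (S n)] lies in [x] and the second one outside [x]. *)
    - replace (ia_meet A x (a (S n))) with
        (ia_join A (ia_meet A x (a n))
          (ia_meet A (ia_g A (ia_join A (a n) x)) (ia_compl A (a n)))).
      + apply (cnf_join HL); [easy|]. apply cnf_meet.
        * apply (cnf_incl HL), g_open.
        * apply (cnf_compl HL), (cnf_incl HL); auto.
      + pose proof (amono1 n) as H. rewrite aS in H |- *.
        pose proof (g_le A (ia_join A (a n) x)) as H1.
        pose proof (g_le A (ia_join A (a n) (ia_compl A x))) as H2.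
        assert (H3 : le (a n) (ia_g A (ia_join A (a n) x)))
          by (apply open_le_g; [easy|ba]).
        clear -H1 H2 H3 H. ba. }
  destruct (not_injective_finite a l) as (i & j & Hij & Eij); [intros; apply Hl|].
  assert (Efix : a (S i) = a i).
  { apply le_antisym; [rewrite Eij; now apply amono|apply amono1]. }
  rewrite aS in Efix. set (c := a i) in *.
  assert (Hc : le c (ia_g A (ia_join A c x))) by (apply open_le_g; [apply aopen|ba]).
  assert (Hc' : le c (ia_g A (ia_join A c (ia_compl A x))))
    by (apply open_le_g; [apply aopen|ba]).
  assert (E1 : ia_g A (ia_join A c x) = c) by (clear -Efix Hc Hc'; ba).
  assert (E2 : ia_g A (ia_join A c (ia_compl A x)) = c) by (clear -Efix Hc Hc'; ba).
  pose proof (Hgrz (fun _ => ia_join A c x)) as G. simpl in G.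
  rewrite E1 in G.
  replace (ia_join A (ia_compl A (ia_join A c x)) c)
    with (ia_join A c (ia_compl A x)) in G by (clear; ba).
  rewrite E2 in G.
  replace (ia_join A (ia_compl A c) (ia_join A c x)) with (ia_one A) in G by (clear; ba).
  rewrite ia_g_one in G.
  assert (E3 : ia_join A c x = ia_one A) by (clear -G; ba).
  assert (E4 : c = ia_one A) by (rewrite <- E1, E3; apply ia_g_one).
  replace x with (ia_meet A x (a i)); [apply acnf|]. fold c. rewrite E4. apply ia_meet_one.
Qed.

Lemma locally_finite_star_cnf E : locally_finite E -> star_variety E ->
  forall A : IntAlg, inV E A -> forall x : A, cnf is_open x.
Proof.
  intros HF HS A HA x.
  destruct (HF A HA [x]) as [l Hl].
  apply cnf_of_grz with (2 := Hl). apply (HS grz); [|easy].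
  intros B HB Hstar v. apply grz_of_cnf. now apply star_algebra_cnf.
Qed.

(** * Local finiteness *)

Fixpoint cells {A : IntAlg} (G : list A) : list A :=
  match G with
  | [] => [ia_one A]
  | y :: G => map (ia_meet A y) (cells G) ++ map (ia_meet A (ia_compl A y)) (cells G)
  end.

Lemma cells_decide (A : IntAlg) (G : list A) (e y : A) : In e (cells G) -> In y G -> decides e y.
Proof.
  revert e; induction G as [|w G IH]; [easy|]. intros e He Hy.
  apply in_app_iff in He as [He|He]; apply in_map_iff in He as (e' & <- & He').
  - destruct Hy as [<-|Hy]; [left; ba|].
    apply decides_le with e'; [ba|auto].
  - destruct Hy as [<-|Hy]; [right; ba|].
    apply decides_le with e'; [ba|auto].
Qed.

Lemma deciding_le_cell (A : IntAlg) (G : list A) (q : A) :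
  (forall y, In y G -> decides q y) -> exists e, In e (cells G) /\ le q e.
Proof.
  induction G as [|w G IH]; intros H.
  - exists (ia_one A). split; [now left|ba].
  - destruct IH as (e & He & Hq); [intros; apply H; now right|].
    destruct (H w) as [Hw|Hw]; [now left| |].
    + exists (ia_meet A w e). split; [apply in_app_iff; left; now apply in_map|ba].
    + exists (ia_meet A (ia_compl A w) e).
      split; [apply in_app_iff; right; now apply in_map|ba].
Qed.

Section LocallyFinite.

Variables (A : IntAlg) (s : list A).
Hypothesis Hcnf : forall x : A, cnf is_open x.
Hypothesis Hcnf_pow : forall x : power_alg nat A, cnf is_open x.

Let val (t : term) : A := eval (fun i => nth i s (ia_zero A)) t.

(** The trace on [a] of the subalgebra generated by [s] is finite; at [a = 1] this is the goal. *)
Definition finite_below (a : A) : Prop :=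
  exists F : list A, forall t, In (ia_meet A (val t) a) F.

Lemma finite_below_join a b :
  finite_below a -> finite_below b -> finite_below (ia_join A a b).
Proof.
  intros [F HF] [G HG].
  exists (map (fun p => ia_join A (fst p) (snd p)) (list_prod F G)).
  intros t. rewrite ia_distr. apply in_map_iff.
  exists (ia_meet A (val t) a, ia_meet A (val t) b).
  split; [easy|]. now apply in_prod.
Qed.

(** Only the interior case of the induction is delicate. If [r] is below [t], then the open element
    [b g(t + -a)] is below [t], inside [a] as well as outside, hence below [g t]. The cell decides
    [g(t + -a)], which depends only on the trace of [t] on [a]. *)
Lemma cell_decides_val (a e : A) (F : list A) :
  (forall t, In (ia_meet A (val t) a) F) ->
  In e (cells (s ++ map (fun y => ia_g A (ia_join A y (ia_compl A a))) F)) ->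
  forall t, decides (ia_meet A (ia_g A (ia_join A a e)) (ia_compl A a)) (val t).
Proof.
  intros HF He.
  set (b := ia_g A (ia_join A a e)). set (r := ia_meet A b (ia_compl A a)).
  assert (Hre : le r e).
  { pose proof (g_le A (ia_join A a e)) as H. fold b in H. clear -H. subst r. ba. }
  assert (HG : forall y, In y (s ++ map (fun y => ia_g A (ia_join A y (ia_compl A a))) F) ->
    decides r y).
  { intros y Hy. apply decides_le with e; [easy|]. now apply cells_decide with (1 := He). }
  assert (Hg : forall t, decides r (ia_g A (ia_join A (val t) (ia_compl A a)))).
  { intros t.
    replace (ia_join A (val t) (ia_compl A a))
      with (ia_join A (ia_meet A (val t) a) (ia_compl A a)) by (clear; ba).
    apply HG, in_app_iff. right.
    apply (in_map (fun y => ia_g A (ia_join A y (ia_compl A a)))), HF. }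
  intros t; induction t as [i| | |t1 IH1 t2 IH2|t1 IH1 t2 IH2|t IH|t IH];
    unfold val; cbn [eval].
  - destruct (nth_in_or_default i s (ia_zero A)) as [H|H].
    + apply HG, in_app_iff. now left.
    + rewrite H. right. clear; ba.
  - right. clear; ba.
  - left. clear; ba.
  - now apply decides_join.
  - now apply decides_meet.
  - now apply decides_compl.
  - fold (val t). pose proof (g_le A (val t)) as Hle.
    destruct IH as [IH|IH]; [|right; clear -IH Hle; ba].
    pose proof (g_le A (ia_join A (val t) (ia_compl A a))) as Hle2.
    pose proof (g_mono (x := val t) (y := ia_join A (val t) (ia_compl A a)) ltac:(clear; ba)) as Hm.
    destruct (Hg t) as [H|H]; [left|right; clear -H Hm; ba].
    assert (K : le (ia_meet A b (ia_g A (ia_join A (val t) (ia_compl A a)))) (ia_g A (val t))).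
    { apply open_le_g; [apply open_meet; apply g_open|].
      clear -IH Hle2. subst r. ba. }
    clear -K H. subst r. ba.
Qed.

(** Passing from [a] to [b], a trace gains either all of [r] or nothing. *)
Lemma finite_below_cell (a e : A) (F : list A) :
  (forall t, In (ia_meet A (val t) a) F) ->
  In e (cells (s ++ map (fun y => ia_g A (ia_join A y (ia_compl A a))) F)) ->
  is_open a -> finite_below (ia_g A (ia_join A a e)).
Proof.
  intros HF He Ha. pose proof (cell_decides_val a e F HF He) as Hd.
  set (b := ia_g A (ia_join A a e)) in *. set (r := ia_meet A b (ia_compl A a)) in *.
  assert (Hab : le a b) by (apply open_le_g; [easy|ba]).
  exists (F ++ map (fun y => ia_join A y r) F). intros t. apply in_app_iff.
  destruct (Hd t) as [H|H].
  - right. replace (ia_meet A (val t) b) with (ia_join A (ia_meet A (val t) a) r)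
      by (clear -H Hab; subst r; ba).
    apply (in_map (fun y => ia_join A y r)), HF.
  - left. replace (ia_meet A (val t) b) with (ia_meet A (val t) a)
      by (clear -H Hab; subst r; ba). apply HF.
Qed.

Definition good (a : A) : Prop := is_open a /\ finite_below a.

Lemma good_zero : good (ia_zero A).
Proof.
  split; [apply open_zero|]. exists [ia_zero A]. intros t. left. ba.
Qed.

Lemma good_join a b : good a -> good b -> good (ia_join A a b).
Proof. intros [? ?] [? ?]. split; auto using open_join, finite_below_join. Qed.

Lemma good_join_list (l : list A) : (forall b, In b l -> good b) ->
  exists a, good a /\ forall b, In b l -> le b a.
Proof.
  induction l as [|b l IH]; intros H.
  - exists (ia_zero A). split; [apply good_zero|easy].
  - destruct IH as (a & Ha & Hle); [intros; apply H; now right|].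
    exists (ia_join A b a). split; [apply good_join; auto; apply H; now left|].
    intros c [<-|Hc]; [ba|]. apply le_trans with a; [auto|ba].
Qed.

Lemma decided_by_list (G : list A) :
  exists U, (forall u, In u U -> is_open u) /\ forall y, In y G -> decided_by U y.
Proof.
  induction G as [|y G (U & HU & HG)].
  - now exists [].
  - destruct (cnf_decided (Hcnf y)) as (W & HW & Hy).
    exists (W ++ U). split.
    + intros u Hu. apply in_app_iff in Hu as [Hu|Hu]; auto.
    + intros w [<-|Hw] q Hq; [apply Hy|apply (HG w Hw)];
        intros u Hu; apply Hq, in_app_iff; auto.
Qed.

(** An open [z] not below [a] can be shrunk to [z'] whose part outside [a] lies in a single cell
    [e]. Then [z'] is below [g(a + e)], hence below [a'], so [z] meets the new layer. *)
Lemma good_step (a : A) : good a -> exists a', good a' /\ le a a' /\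
  forall z, is_open z -> ia_meet A z (ia_meet A a' (ia_compl A a)) = ia_zero A -> le z a.
Proof.
  intros [Ha [F HF]].
  set (G := s ++ map (fun y => ia_g A (ia_join A y (ia_compl A a))) F).
  destruct (good_join_list (map (fun e => ia_g A (ia_join A a e)) (cells G)))
    as (a1 & Ha1 & Hle).
  { intros b Hb. apply in_map_iff in Hb as (e & <- & He).
    split; [apply g_open|now apply finite_below_cell with F]. }
  exists (ia_join A a a1). split; [|split].
  - apply good_join; [|easy]. split; [easy|now exists F].
  - clear; ba.
  - intros z Hz E. apply NNPP; intros Hn.
    destruct (decided_by_list G) as (U & HU & HG).
    destruct (@open_refine A U z (ia_compl A a) HU Hz) as (z' & Hz' & Hzz & Hne & Hd).
    { intros H. apply Hn. clear -H. ba. }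
    destruct (@deciding_le_cell A G (ia_meet A z' (ia_compl A a))) as (e & He & Hqe).
    { intros y Hy. apply (HG y Hy). intros u Hu.
      destruct (Hd u Hu) as [H|H]; [left|right]; clear -H; ba. }
    assert (H1 : le z' (ia_g A (ia_join A a e))).
    { apply open_le_g; [easy|]. clear -Hqe. ba. }
    assert (H2 : le (ia_g A (ia_join A a e)) a1).
    { apply Hle. now apply (in_map (fun e => ia_g A (ia_join A a e))). }
    apply Hne. clear -H1 H2 Hzz E. ba.
Qed.

(** * Alternation along a chain of layers *)

Definition alternates (N : nat) (l : nat -> A) (x : A) : Prop :=
  forall i, i < N ->
    (le (l i) x /\ le (l (S i)) (ia_compl A x)) \/
    (le (l i) (ia_compl A x) /\ le (l (S i)) x).

(* Climbing one layer up, either the membership in some [u] of [U] is gained for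
   good, or the two layers agree on [U] and hence on [x]. *)
Lemma alternation_bound (N : nat) (l : nat -> A) (x : A) :
  (forall i z, is_open z -> ia_meet A z (l i) = ia_zero A ->
     ia_meet A z (l (S i)) = ia_zero A) ->
  alternates N l x ->
  forall n U z i, length U = n -> (forall u, In u U -> is_open u) -> is_open z ->
    (forall q, le q z -> (forall u, In u U -> decides q u) -> decides q x) ->
    n <= i -> i < N -> ia_meet A z (l (S i)) = ia_zero A.
Proof.
  intros Hl Halt n; induction n as [|n IH]; intros U z i HUn HU Hz Hd Hn HN;
    apply NNPP; intros Hne;
    assert (Hne' : ia_meet A z (l i) <> ia_zero A) by (intros H; apply Hne; auto);
    (destruct (classic (exists u, In u U /\ ia_meet A (ia_meet A z u) (l i) <> ia_zero A))
      as [(u & Hu & Hui)|Hall];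
    (* Within [z], no [u] meets layer [i], so none meets layer [S i]. Hence [q] avoids all of [U]
       and decides [x], against the alternation. *)
    [|set (q := ia_meet A z (ia_join A (l i) (l (S i))));
      assert (Hq : decides q x);
      [ apply Hd; [clear; subst q; ba|];
        intros u Hu; right;
        assert (H1 : ia_meet A (ia_meet A z u) (l i) = ia_zero A)
          by (apply NNPP; intros H; apply Hall; eauto);
        assert (H2 : ia_meet A (ia_meet A z u) (l (S i)) = ia_zero A)
          by (apply Hl; [apply open_meet; auto|easy]);
        clear -H1 H2; subst q; ba
      | destruct (Halt i HN) as [[H1 H2]|[H1 H2]], Hq as [H|H];
        [apply Hne|apply Hne'|apply Hne'|apply Hne]; clear -H H1 H2; subst q; ba ]]).
  - destruct U; easy.
  - destruct i as [|i]; [lia|].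
    destruct (in_split _ _ Hu) as (U1 & U2 & ->).
    apply Hui. apply IH with (U := U1 ++ U2); try lia.
    + rewrite length_app in *. simpl in HUn. lia.
    + intros w Hw. apply HU. rewrite in_app_iff in *. simpl. tauto.
    + apply open_meet; auto.
    + intros q Hq Hdq. apply Hd.
      * clear -Hq. ba.
      * intros w Hw. apply in_app_iff in Hw as [Hw|[<-|Hw]];
          [apply Hdq, in_app_iff; auto| |apply Hdq, in_app_iff; auto].
        left. clear -Hq. ba.
Qed.

Section Layers.

Variable a : nat -> A.
Hypothesis amono1 : forall n, le (a n) (a (S n)).

Let layer (n : nat) : A := ia_meet A (a (S n)) (ia_compl A (a n)).

Fixpoint even_layers (n : nat) : A :=
  match n with
  | 0 => ia_zero A
  | S n => if Nat.even n then ia_join A (even_layers n) (layer n) else even_layers n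
  end.

Lemma layers_mono i j : i <= j -> le (a i) (a j).
Proof.
  intros Hij; induction Hij as [|j Hij IH]; [ba|]. apply le_trans with (a j); auto.
Qed.

Lemma even_layers_le n : le (even_layers n) (a n).
Proof.
  induction n as [|n IH]; simpl; [ba|].
  pose proof (amono1 n) as H. unfold layer.
  destruct (Nat.even n); clear -H IH; ba.
Qed.

(** Layers are disjoint: layer [i] is below [a (S i)], and later layers lie outside it. *)
Lemma layer_even_layers n i : i < n ->
  if Nat.even i then le (layer i) (even_layers n)
  else le (layer i) (ia_compl A (even_layers n)).
Proof.
  induction n as [|n IH]; [lia|]. intros Hi. simpl.
  destruct (Nat.eq_dec i n) as [->|Hne].
  - pose proof (even_layers_le n) as H. unfold layer.
    destruct (Nat.even n); clear -H; ba.
  - specialize (IH ltac:(lia)).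
    pose proof (@layers_mono (S i) n ltac:(lia)) as H.
    destruct (Nat.even i), (Nat.even n); unfold layer in *; clear -H IH; ba.
Qed.

(** The [N] alternations involve the layers 0 to [N], hence the index [S N]. *)
Lemma even_layers_alternates N : alternates N layer (even_layers (S N)).
Proof.
  intros i Hi.
  pose proof (@layer_even_layers (S N) i ltac:(lia)) as H1.
  pose proof (@layer_even_layers (S N) (S i) ltac:(lia)) as H2.
  rewrite Nat.even_succ, <- Nat.negb_even in H2.
  destruct (Nat.even i); simpl in H2; [left|right]; easy.
Qed.

(** The sequence of even sums is one element of a power of [A], so a single [n] bounds the number of
    open elements needed in every coordinate. *)
Lemma layers_reach_one :
  (forall n z, is_open z -> ia_meet A z (layer n) = ia_zero A -> le z (a n)) ->
  exists n, a n = ia_one A.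
Proof.
  intros Hdense.
  destruct (cnf_power_decided (Hcnf_pow (fun n => even_layers (S n)))) as [n Hn].
  exists (S n). destruct (Hn (S n)) as (U & HUn & HU & Hd).
  assert (Hz : ia_meet A (ia_one A) (layer (S n)) = ia_zero A).
  (* Coordinate [S n] alternates [S n] times but is decided by [n] open elements; the bound is used
     at [i = n]. *)
  { eapply alternation_bound with (N := S n) (U := U) (l := layer);
      [|apply even_layers_alternates|exact HUn|exact HU|apply open_one| |lia|lia].
    - intros i z Hz H. apply Hdense in H; [|easy].
      pose proof (amono1 i) as H1. unfold layer. clear -H H1. ba.
    - intros q _ Hq. now apply Hd. }
  apply Hdense in Hz; [|apply open_one]. clear -Hz. ba.
Qed.

End Layers.

(** Iterating [good_step] from 0 reaches 1, and [finite_below] at 1 is the claim. *)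
Lemma generated_finite : exists l : list A, forall t, In (val t) l.
Proof.
  assert (Hstep : forall a : {a | good a}, exists a' : {a | good a},
    le (proj1_sig a) (proj1_sig a') /\
    forall z, is_open z ->
      ia_meet A z (ia_meet A (proj1_sig a') (ia_compl A (proj1_sig a))) = ia_zero A ->
      le z (proj1_sig a)).
  { intros [a Ha]. destruct (good_step Ha) as (a' & Ha' & H). now exists (exist _ a' Ha'). }
  destruct (functional_choice _ Hstep) as [next Hnext].
  set (b := fun n => Nat.iter n next (exist _ (ia_zero A) good_zero)).
  destruct (@layers_reach_one (fun n => proj1_sig (b n))) as [n En].
  - intros n. exact (proj1 (Hnext (b n))).
  - intros n. exact (proj2 (Hnext (b n))).
  - destruct (proj2_sig (b n)) as [_ [F HF]]. rewrite En in HF.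
    exists F. intros t. rewrite <- (ia_meet_one A (val t)). apply HF.
Qed.

End LocallyFinite.

Lemma O_full_locally_finite E : O_full E -> locally_finite E.
Proof.
  intros HF A HA s. apply generated_finite.
  - now apply (O_full_cnf HF).
  - now apply (O_full_cnf HF), inV_power_alg.
Qed.

(** * The categorical equivalence *)

Definition opens_map (A B : IntAlg) (h : IHom A B) : HHom (opens A) (opens B).
Proof.
  refine (@Build_HHom (opens A) (opens B)
    (fun a => exist _ (h (proj1_sig a))
       (eq_trans (eq_sym (ih_g h (proj1_sig a))) (f_equal h (proj2_sig a))))
    _ _ _ _ _); intros; apply sig_eq; simpl;
  rewrite ih_g, ?ih_zero, ?ih_one, ?ih_join, ?ih_meet, ?ih_compl; reflexivity.
Defined.

Definition hhom_id (H : HAlg) : HHom H H.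
Proof. refine (@Build_HHom H H (fun x => x) _ _ _ _ _); reflexivity. Defined.

Lemma HIso_refl (H : HAlg) : HIso H H.
Proof. now exists (hhom_id H), (hhom_id H). Qed.

(** The functor is the restriction to open elements; it is faithful because these generate every
    member of the variety. *)
Lemma O_full_cat_equiv E : O_full E -> cat_equiv E.
Proof.
  intros HF.
  exists (fun A _ => opens A), (fun A B _ _ h => opens_map h).
  split; [|split; [|split; [|split; [|split]]]].
  - intros A hA. exists A. split; [easy|apply HIso_refl].
  - intros A hA x. now apply sig_eq.
  - intros. now apply sig_eq.
  - intros A B hA hB h1 h2 H y. apply ihom_agree_cnf.
    + intros a Ha. exact (f_equal (@proj1_sig _ _) (H (exist _ a Ha))).
    + now apply (O_full_cnf HF).
  - intros A B hA hB f. destruct (HF A B hA hB f) as [h Hh].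
    exists h. intros x. apply sig_eq. symmetry. apply Hh.
  - intros H (A & hA & Hiso). now exists A, hA.
Qed.

Theorem theorem5p11 (E : term * term -> Prop) :
  (O_full E <-> (locally_finite E /\ star_variety E)) /\
  (locally_finite E /\ star_variety E -> cat_equiv E).
Proof.
  assert (Hfull : locally_finite E /\ star_variety E -> O_full E).
  { intros [HF HS] A B HA HB f. apply hhom_extension.
    now apply (locally_finite_star_cnf HF HS). }
  split; [split|].
  - intros HO. split; [now apply O_full_locally_finite|].
    (* Every member is itself a *-algebra, so an equation valid in the *-algebras applies to it
       directly. *)
    intros e He A HA. apply He; [easy|]. apply star_algebra_cnf. now apply (O_full_cnf HO).
  - exact Hfull.
  - intros H. now apply O_full_cat_equiv, Hfull.
Qed.
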